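(* Let $X$ be a complete metric space without isolated points. Then a typical nonempty compact subset of $X$ is homeomorphic to the attractor of a Banach contractive iterated function system; that is, the set of all $K\in\mathcal{K}(X)$ that are homeomorphic to the attractor of some Banach contractive IFS (on some complete metric space) is residual in $(\mathcal{K}(X),d_H)$.
   Context: $\mathcal{K}(X)$ is the set of nonempty compact subsets of $X$ with the Hausdorff metric $d_H$; residual means that the complement is a countable union of nowhere dense sets. A Banach contractive IFS on a metric space $Y$ is a finite family $\mathcal{F}=\{w_1,\dots,w_N\}$ of maps $w_i:Y\to Y$ with Lipschitz constants $<1$. Its Hutchinson operator is $\mathcal{F}(K)=\bigcup_{i=1}^N w_i(K)$, $K\in\mathcal{K}(Y)$. Its attractor is the set $A\in\mathcal{K}(Y)$ with $\mathcal{F}(A)=A$ and $\mathcal{F}^k(K)\to A$ in the Hausdorff metric for every $K\in\mathcal{K}(Y)$. *)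

(* Defs.v *)
From HB Require Import structures.
From mathcomp Require Import all_boot all_order all_algebra.
From mathcomp Require Import all_classical all_reals all_analysis.

Set Implicit Arguments.
Unset Strict Implicit.
Unset Printing Implicit Defensive.

Import Order.TTheory GRing.Theory Num.Theory.
Import numFieldNormedType.Exports.

Local Open Scope classical_set_scope.
Local Open Scope ring_scope.

(* [completeType] requires a point; this predicate has the same content but
   also makes sense for a possibly empty space. *)
Definition complete_space (T : uniformType) : Prop :=
  forall F : set_system T, ProperFilter F -> cauchy F -> exists l : T, F --> l.

Definition nowhere_dense (T : topologicalType) (A : set T) : Prop :=
  interior (closure A) = set0.

Definition residual (T : topologicalType) (A : set T) : Prop :=
  exists2 F : nat -> set T,
    (forall n, nowhere_dense (F n)) & ~` A = \bigcup_n F n.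

Definition homeomorphic (S T : topologicalType) : Prop :=
  exists (f : S -> T) (g : T -> S),
    [/\ continuous f, continuous g, cancel f g & cancel g f].

Section Distances.
Context {R : realType} {X : metricType R}.
Implicit Types (x y a b : X) (A B C : set X).

Definition dist_set x B : R := inf [set mdist x b | b in B].

Definition excess A B : R := sup [set dist_set a B | a in A].

Definition hausdorff_dist A B : R := Num.max (excess A B) (excess B A).

Lemma dist_set_lbound x B : lbound [set mdist x b | b in B] 0.
Proof. by move=> _ [b _ <-]; exact: mdist_ge0. Qed.

Lemma dist_set_ge0 x B : B !=set0 -> 0 <= dist_set x B.
Proof.
move=> [b Bb]; apply: lb_le_inf; first by exists (mdist x b), b.
exact: dist_set_lbound.
Qed.

Lemma dist_set_le x b B : B b -> dist_set x B <= mdist x b.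
Proof.
move=> Bb; apply: ge_inf; last by exists b.
by exists 0; exact: dist_set_lbound.
Qed.

Lemma dist_set_triangle x y B :
  B !=set0 -> dist_set x B <= mdist x y + dist_set y B.
Proof.
move=> [b0 Bb0]; rewrite -lerBlDl; apply: lb_le_inf.
  by exists (mdist y b0), b0.
move=> _ [b Bb <-]; rewrite lerBlDl.
exact: le_trans (dist_set_le x Bb) (metric_triangle _ _ _).
Qed.

Lemma compact_dist_bounded A b :
  compact A -> exists M : R, forall a, A a -> mdist a b <= M.
Proof.
move=> cA.
have cf : continuous (fun x : X => mdist x b : R^o).
  move=> x; apply/cvgrPdist_le => e e0.
  have : nbhs x (ball x e) by exact: nbhsx_ballx.
  apply: filterS => y; rewrite ballEmdist /= => /ltW xye.
  apply: le_trans xye; rewrite ler_norml.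
  have := metric_triangle x y b; have := metric_triangle y x b.
  rewrite (metric_sym y x) => yxb xyb.
  by rewrite lerNl opprB !lerBlDr yxb xyb.
have /compact_bounded [M [_ HM]] :=
  continuous_compact (continuous_subspaceT cf) cA.
exists (M + 1) => a Aa; apply: le_trans (ler_norm _) _.
by apply: (HM (M + 1)); [rewrite ltrDl|exists a].
Qed.

Lemma le_excess A B a : compact A -> B !=set0 -> A a ->
  dist_set a B <= excess A B.
Proof.
move=> cA [b Bb] Aa; apply: ub_le_sup; last by exists a.
have [M HM] := compact_dist_bounded b cA.
exists M => _ [a' Aa' <-].
exact: le_trans (dist_set_le _ Bb) (HM _ Aa').
Qed.

Lemma excess_le A B e : A !=set0 ->
  (forall a, A a -> dist_set a B <= e) -> excess A B <= e.
Proof.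
move=> [a Aa] H; apply: ge_sup; first by exists (dist_set a B), a.
by move=> _ [a' Aa' <-]; exact: H.
Qed.

Lemma excess_triangle A B C : compact A -> compact B ->
  A !=set0 -> B !=set0 -> C !=set0 ->
  excess A C <= excess A B + excess B C.
Proof.
move=> cA cB A0 B0 C0; apply: excess_le => // a Aa.
have : dist_set a C - excess B C <= dist_set a B.
  case: (B0) => b0 Bb0.
  apply: lb_le_inf; first by exists (mdist a b0), b0.
  move=> _ [b Bb <-]; rewrite lerBlDr.
  apply: le_trans (dist_set_triangle a b C0) _.
  by rewrite lerD2l; exact: le_excess.
rewrite lerBlDr => /le_trans; apply; rewrite lerD2r; exact: le_excess.
Qed.

Lemma excess_le0_sub A B : compact A -> compact B -> B !=set0 ->
  excess A B <= 0 -> A `<=` B.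
Proof.
move=> cA cB B0 AB0 a Aa.
have : closed B by exact: (compact_closed (@metric_hausdorff _ X)).
apply=> U; rewrite -nbhs_ballE => -[e /= e0 aeU].
have /inf_lt : dist_set a B < e.
  by apply: le_lt_trans e0; apply: le_trans AB0; exact: le_excess.
case; first by case: B0 => b Bb; exists (mdist a b), b.
move=> _ [b Bb <-] abe; exists b; split => //.
by apply: aeU; rewrite ballEmdist.
Qed.

End Distances.

Record hyperspace (R : realType) (X : metricType R) := Hyperspace {
  hset :> set X ;
  hset_compact : compact hset ;
  hset_nonempty : hset !=set0 }.

Section HausdorffMetric.
Context {R : realType} {X : metricType R}.
Implicit Types K L M : hyperspace X.

Lemma hyperspace_eq K L : hset K = hset L -> K = L.
Proof.
case: K => K cK K0; case: L => L cL L0 /= KL; subst L.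
by congr Hyperspace; exact: Prop_irrelevance.
Qed.

HB.instance Definition _ := gen_eqMixin (hyperspace X).
HB.instance Definition _ := gen_choiceMixin (hyperspace X).

Definition hdist K L : R := hausdorff_dist K L.

Lemma hdistxx K : hdist K K = 0.
Proof.
rewrite /hdist /hausdorff_dist maxxx; apply/eqP; rewrite eq_le.
have K0 := hset_nonempty K; apply/andP; split.
  apply: excess_le => // a Ka.
  by rewrite -[leRHS](mdistxx a); exact: dist_set_le.
have [a Ka] := K0; apply: (le_trans (dist_set_ge0 a K0)).
by apply: le_excess => //; exact: hset_compact.
Qed.

Lemma hdist_positivity K L : hdist K L = 0 -> K = L.
Proof.
move=> KL0; apply: hyperspace_eq.
have : hdist K L <= 0 by rewrite KL0.
rewrite /hdist /hausdorff_dist ge_max => /andP[KL LK].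
by apply/seteqP; split; apply: excess_le0_sub => //;
  solve [exact: hset_compact | exact: hset_nonempty].
Qed.

Lemma hdist_sym K L : hdist K L = hdist L K.
Proof. by rewrite /hdist /hausdorff_dist maxC. Qed.

Lemma hdist_triangle L K M : hdist K M <= hdist K L + hdist L M.
Proof.
rewrite {1}/hdist {1}/hausdorff_dist ge_max; apply/andP; split.
  apply: (@le_trans _ _ (excess K L + excess L M)).
    by apply: excess_triangle;
      solve [exact: hset_compact | exact: hset_nonempty].
  by apply: lerD; rewrite /hdist /hausdorff_dist le_max lexx.
apply: (@le_trans _ _ (excess M L + excess L K)).
  by apply: excess_triangle;
    solve [exact: hset_compact | exact: hset_nonempty].
rewrite addrC.
by apply: lerD; rewrite /hdist /hausdorff_dist le_max lexx orbT.
Qed.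

HB.instance Definition _ := @isMetric.Build R (hyperspace X)
  hdist hdistxx hdist_positivity hdist_sym hdist_triangle.

End HausdorffMetric.

Definition metric_contraction (R : realType) (Y : metricType R)
    (w : Y -> Y) : Prop :=
  exists2 q : R, 0 <= q < 1 & forall x y, mdist (w x) (w y) <= q * mdist x y.

(* The family has [ifs_size.+1 >= 1] maps: the Hutchinson operator of the empty
   family does not take values in the nonempty compact sets. *)
Record banach_ifs (R : realType) (Y : metricType R) := BanachIFS {
  ifs_size : nat ;
  ifs_map : 'I_ifs_size.+1 -> Y -> Y ;
  ifs_contraction : forall i, metric_contraction (ifs_map i) }.

Arguments ifs_map {R Y} b i y.

Section Hutchinson.
Context {R : realType} {Y : metricType R}.
Implicit Types (F : banach_ifs Y) (K A : hyperspace Y).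

Definition hutchinson_set F (K : set Y) : set Y :=
  \bigcup_i (ifs_map F i @` K).

Lemma metric_contraction_continuous (w : Y -> Y) :
  metric_contraction w -> continuous w.
Proof.
move=> [q /andP[q0 q1] wq] x.
apply/metricType_numDomainType.cvgrPdist_lt => e e0.
have : nbhs x (ball x e) by exact: nbhsx_ballx.
apply: filterS => y; rewrite ballEmdist /= => xye.
apply: le_lt_trans (wq x y) _; apply: le_lt_trans xye.
by rewrite ler_piMl ?mdist_ge0// ltW.
Qed.

Lemma hutchinson_compact F K : compact (hutchinson_set F K).
Proof.
rewrite /hutchinson_set -(bigsetU_fset_set _ (@finite_finset _ setT)).
apply: bigsetU_compact => i _; apply: continuous_compact.
  apply: continuous_subspaceT; apply: metric_contraction_continuous.
  exact: ifs_contraction.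
exact: hset_compact.
Qed.

Lemma hutchinson_nonempty F K : hutchinson_set F K !=set0.
Proof.
have [x Kx] := hset_nonempty K.
by exists (ifs_map F ord0 x), ord0 => //; exists x.
Qed.

Definition hutchinson F K : hyperspace Y :=
  Hyperspace (@hutchinson_compact F K) (@hutchinson_nonempty F K).

Definition is_attractor F A : Prop :=
  hutchinson F A = A /\
  forall K, iter k (hutchinson F) K @[k --> \oo] --> A.

End Hutchinson.

(* Main.v *)
(* A typical compact set is a Cantor set, and the Cantor space, metrized by
   d(x, y) = 2^-n with n the first index where x and y differ, is the attractor
   of the two maps prepending a bit, which are contractions of ratio 1/2.
   A compact K is a Cantor set as soon as, at every scale r > 0, each of its
   points x has another point of K within r and some radius e < r such that the
   sphere of radius e around x misses K.  For fixed r both conditions hold, with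
   a margin, for finite sets in which every point has another one within r/2,
   hence on a Hausdorff neighbourhood of them; since X has no isolated points
   such finite sets are dense (double the points of a finite net). *)
Require Import Defs.
From HB Require Import structures.
From mathcomp Require Import all_boot all_order all_algebra.
From mathcomp Require Import all_classical all_reals all_analysis.
From mathcomp Require Import lra.

Set Implicit Arguments.
Unset Strict Implicit.
Unset Printing Implicit Defensive.

Import Order.TTheory GRing.Theory Num.Theory.
Import numFieldNormedType.Exports.

Local Open Scope classical_set_scope.
Local Open Scope ring_scope.

(** * The Hausdorff distance in terms of points *)

Section HausdorffDistance.
Context {R : realType} {X : metricType R}.
Implicit Types (K L : hyperspace X) (e : R).

Lemma hdist_le K L e :
  (forall x, hset K x -> exists2 y, hset L y & mdist x y <= e) ->
  (forall y, hset L y -> exists2 x, hset K x & mdist y x <= e) ->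
  hdist K L <= e.
Proof.
move=> KL LK; rewrite /hdist /hausdorff_dist ge_max; apply/andP; split.
  apply: excess_le => [|x /KL[y Ly]]; first exact: hset_nonempty.
  by apply: le_trans; exact: dist_set_le.
apply: excess_le => [|y /LK[x Kx]]; first exact: hset_nonempty.
by apply: le_trans; exact: dist_set_le.
Qed.

Lemma hdist_lt_near K L e x : hdist K L < e -> hset K x ->
  exists2 y, hset L y & mdist x y < e.
Proof.
rewrite /hdist /hausdorff_dist gt_max => /andP[KLe _] Kx.
have L0 := hset_nonempty L.
have /inf_lt : dist_set x L < e.
  by apply: le_lt_trans KLe; apply: le_excess => //; exact: hset_compact.
case; first by case: L0 => y Ly; exists (mdist x y), y.
by move=> _ [y Ly <-] xye; exists y.
Qed.

End HausdorffDistance.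

(** * Separation, finite nets and isolated points *)

Section MetricSpace.
Context {R : realType} {X : metricType R}.

Lemma min_separation (s : seq X) :
  exists2 r : R, 0 < r & {in s &, forall x y, x != y -> r <= mdist x y}.
Proof.
pose D := [seq d <- [seq mdist x y | x <- s, y <- s] | 0 < d].
(* The default 1 keeps the minimum positive when [s] has no two distinct points. *)
exists (\big[Num.min/1]_(d <- D) d) => [|x y xs ys xy].
  rewrite big_seq; elim/big_ind: _ => // [u v u0 v0|d].
    by rewrite lt_min u0 v0.
  by rewrite mem_filter => /andP[].
apply: ge_bigmin_seq => //.
by rewrite mem_filter mdist_gt0 xy; apply/allpairsP; exists (x, y).
Qed.

Lemma compact_net (A : set X) (e : R) : 0 < e -> compact A ->
  exists s : seq X,
    (forall x, x \in s -> A x) /\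
    (forall a, A a -> exists2 x, x \in s & mdist x a < e).
Proof.
move=> e0 cA; have [[a0 _]|A0] := pselect (A !=set0); last first.
  by exists [::]; split=> // a Aa; case: A0; exists a.
(* The cover characterization of compactness is applied on a pointed space; [a0] serves as the
   point. *)
pose XP : ptopologicalType := HB.pack (Metric.sort X) (isPointed.Build X a0).
move: (cA : @compact XP A).
rewrite compact_cover => /(_ X A (fun x => (ball x e)^°)).
case=> [x _|a Aa|s sA Acov]; first exact: open_interior.
  by exists a => //; apply: nbhs_singleton; apply: nbhs_interior;
    exact: nbhsx_ballx.
exists (finmap.enum_fset s).
split=> [x /sA/set_mem//|a /Acov[x xs /interior_subset]].
by rewrite ballEmdist => xa; exists x.
Qed.

Lemma isolated0_near (x : X) (e : R) : isolated [set: X] = set0 -> 0 < e ->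
  exists2 y, y != x & mdist x y < e.
Proof.
move=> iso e0; apply: contrapT => nx.
have : isolated [set: X] x.
  split; first by rewrite inE.
  exists (ball x e); first exact: nbhsx_ballx.
  rewrite setIT ballEmdist; apply/seteqP; split => [y /= xy|_ ->/=].
    by apply: contrapT => /eqP yx; apply: nx; exists y.
  by rewrite mdistxx.
by rewrite iso.
Qed.

End MetricSpace.

(** * The Cantor conditions hold on a residual set *)

Section CantorAtScale.
Context {R : realType} {X : metricType R}.
Implicit Types (A : set X) (K L : hyperspace X) (r : R).

(* The sphere of radius [e] around [x] misses [A], so the ball of radius [e] is
   relatively clopen in [A]. *)
Definition cantor_at_scale r A := forall x, A x ->
  (exists y, [/\ A y, y != x & mdist x y < r]) /\
  (exists2 e, 0 < e < r & forall y, A y -> mdist x y != e).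

(** Each point of an [e / 2]-net of [K] is doubled by a distinct point closer than both [r] and
    [e / 2], so the two copies are neighbours of each other and the doubled net stays within [e / 2]
    of [K]. *)
Lemma cantor_at_scale_dense K r e : isolated [set: X] = set0 ->
  0 < r -> 0 < e ->
  exists s : seq X, exists2 L : hyperspace X, hset L = [set` s] &
    hdist K L < e /\
    {in s, forall x, exists2 y, y \in s & y != x /\ mdist x y < r}.
Proof.
move=> iso r0 e0; have e20 : 0 < e / 2 by lra.
have [s [sK Ks]] := compact_net e20 (hset_compact (h := K)).
have me : 0 < Num.min r (e / 2) by rewrite lt_min r0.
have /choice[f fP] : forall x : X, exists y : X,
    y != x /\ mdist x y < Num.min r (e / 2).
  by move=> x; have [y] := isolated0_near x iso me; exists y.
have fr x : mdist x (f x) < r.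
  by have [_] := fP x; rewrite lt_min => /andP[].
have fe x : mdist x (f x) < e / 2.
  by have [_] := fP x; rewrite lt_min => /andP[].
pose t := s ++ map f s.
have ct : compact [set` t] by apply: finite_compact; apply/finite_seqP; exists t.
have t0 : [set` t] !=set0.
  have [x /Ks[y ys _]] := hset_nonempty K.
  by exists y => /=; rewrite mem_cat ys.
exists t, (Hyperspace ct t0) => //; split.
  apply: (@le_lt_trans _ _ (e / 2)); last lra.
  apply: hdist_le => [x /Ks[y ys /ltW]|x /=].
    by rewrite metric_sym => ?; exists y => //=; rewrite mem_cat ys.
  rewrite mem_cat => /orP[xs|/mapP[y ys ->]].
    by exists x; [exact: sK|rewrite mdistxx ltW].
  by exists y; [exact: sK|rewrite metric_sym ltW].
move=> x; rewrite mem_cat => /orP[xs|/mapP[y ys ->]].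
  by exists (f x); [rewrite mem_cat map_f ?orbT|case: (fP x)].
exists y; first by rewrite mem_cat ys.
by case: (fP y) => fy _; rewrite eq_sym metric_sym.
Qed.

(** With [e] at most half the separation [m] of [s], two points of [K] lying within [e / 4] of the
    same point of [s] are less than [e / 2] apart, and near distinct points of [s] more than
    [m - e / 2 >= 3 * e / 2] apart. Hence the distance [e] never occurs in [K]. *)
Lemma cantor_at_scale_near_finite r (s : seq X) L : 0 < r ->
  hset L = [set` s] ->
  {in s, forall x, exists2 y, y \in s & y != x /\ mdist x y < r / 2} ->
  exists2 d : R, 0 < d & forall K, hdist L K < d -> cantor_at_scale r K.
Proof.
move=> r0 Ls sP; have [m m0 mP] := min_separation s.
pose e := Num.min m r / 2.
have em : e <= m / 2 by rewrite /e ler_pM2r// ge_min lexx.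
have er : e <= r / 2 by rewrite /e ler_pM2r// ge_min lexx orbT.
have e0 : 0 < e by rewrite divr_gt0// lt_min m0.
exists (e / 4) => [|K LK x Kx]; first lra.
have near z : hset K z -> exists2 z', z' \in s & mdist z z' < e / 4.
  move: LK; rewrite hdist_sym => /hdist_lt_near KL /KL[z' + zz'].
  by rewrite Ls; exists z'.
have [x' x's xx'] := near x Kx; split.
  (* The neighbour of [x'] in [s] is followed back to [K]: the distance to [x] stays positive, and
     is below [r / 2 + e / 2 < r]. *)
  have [y' y's [y'x' x'y']] := sP x' x's.
  have [y Ky y'y] : exists2 y, hset K y & mdist y' y < e / 4.
    by apply: hdist_lt_near LK _; rewrite Ls.
  have := mP x' y' x's y's; rewrite eq_sym y'x' => /(_ isT) mx'y'.
  have T1 := metric_triangle x x' y; have T2 := metric_triangle x' y' y.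
  have T3 := metric_triangle x' x y'; have T4 := metric_triangle x y y'.
  rewrite (metric_sym x' x) (metric_sym y y') in T3 T4.
  exists y; split => //; last lra.
  by rewrite eq_sym -mdist_gt0; lra.
exists e; first by apply/andP; split => //; lra.
move=> y Ky; apply/eqP => xye; have [y' y's yy'] := near y Ky.
have T1 := metric_triangle x x' y; have T2 := metric_triangle x' y' y.
have T3 := metric_triangle x' x y'; have T4 := metric_triangle x y y'.
rewrite (metric_sym x' x) in T3; rewrite (metric_sym y' y) in T2.
have [x'y'|/mP] := eqVneq x' y'; last by move=> /(_ x's y's); lra.
by subst y'; rewrite mdistxx in T2; lra.
Qed.

Lemma cantor_at_scale_nowhere_dense r : isolated [set: X] = set0 -> 0 < r ->
  nowhere_dense [set K : hyperspace X | ~ cantor_at_scale r K].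
Proof.
move=> iso r0; apply/seteqP; split=> // K.
rewrite /interior -nbhs_ballE => -[e /= e0 Ke].
have r20 : 0 < r / 2 by lra.
have [s [L Ls [KL sP]]] := cantor_at_scale_dense K iso r20 e0.
have [d d0 dP] := cantor_at_scale_near_finite r0 Ls sP.
have /Ke : ball K e L by rewrite ballEmdist.
(* [L] would be in the closure of the bad set, yet the ball of radius [d] around it contains no bad
   set. *)
move=> /(_ (ball L d) (nbhsx_ballx _ _ d0))[M [nM]].
by rewrite ballEmdist => /dP.
Qed.

Lemma cantor_at_scale_residual : isolated [set: X] = set0 ->
  residual [set K : hyperspace X | forall n, cantor_at_scale n.+1%:R^-1 K].
Proof.
move=> iso.
exists (fun n => [set K : hyperspace X | ~ cantor_at_scale n.+1%:R^-1 K]).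
  by move=> n; apply: cantor_at_scale_nowhere_dense; rewrite ?invr_gt0.
apply/seteqP; split=> K /=; first by move=> /existsNP[n nK]; exists n.
by move=> [n _ nK] /(_ n).
Qed.

End CantorAtScale.

Lemma residualS (T : topologicalType) (A B : set T) :
  A `<=` B -> residual A -> residual B.
Proof.
(* [residual] asks for the complement to equal the union, so the sets are cut down to the complement
   of [B]. *)
move=> AB [F Fnd AF]; exists (fun n => F n `&` ~` B).
  move=> n; have := Fnd n; rewrite /nowhere_dense -!subset0.
  apply: subset_trans; apply: interiorS; apply: closureS; exact: subIsetl.
rewrite -setI_bigcupl -AF; apply/seteqP; split=> x /=; last by case.
by move=> nB; split=> // /AB.
Qed.

(** * Homeomorphisms and compact subspaces *)

Section Homeomorphic.
Implicit Types S T U : topologicalType.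

Lemma homeomorphic_sym S T : homeomorphic S T -> homeomorphic T S.
Proof. by move=> [f [g [cf cg fK gK]]]; exists g, f. Qed.

Lemma homeomorphic_trans S T U :
  homeomorphic S T -> homeomorphic T U -> homeomorphic S U.
Proof.
move=> [f [g [cf cg fK gK]]] [f' [g' [cf' cg' f'K g'K]]].
exists (f' \o f), (g \o g'); split.
- by move=> x; apply: continuous_comp; [exact: cf|exact: cf'].
- by move=> x; apply: continuous_comp; [exact: cg'|exact: cg].
- exact: can_comp.
- exact: can_comp.
Qed.

Lemma injective_continuous_hausdorff S T (f : S -> T) :
  injective f -> continuous f -> hausdorff_space T -> hausdorff_space S.
Proof.
move=> finj cf hT p q pq; apply: finj; apply: hT => A B /cf fA /cf fB.
by have [z [? ?]] := pq _ _ fA fB; exists (f z).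
Qed.

Lemma compact_hausdorff_homeomorphic S T (f : S -> T) :
  compact [set: S] -> hausdorff_space T -> continuous f -> bijective f ->
  homeomorphic S T.
Proof.
move=> cS hT cf [g fK gK]; exists f, g; split => //.
apply/continuous_closedP => A clA.
(* Preimages under the inverse are images under [f]: closed sets become compact, hence closed. *)
have -> : g @^-1` A = f @` A.
  apply/seteqP; split=> [y /= Agy|_ [x Ax <-] /=]; last by rewrite fK.
  by exists (g y); rewrite ?gK.
apply: compact_closed => //; apply: continuous_compact.
  exact: continuous_subspaceT.
exact: subclosed_compact clA cS _.
Qed.

Lemma compact_set_type T (A : set T) : compact A -> compact [set: set_type A].
Proof.
move=> cA F PF _.
(* The filter is pushed forward to [T], where compactness of [A] gives a cluster point, which then
   lifts to the subspace. *)
have /cA[p [Ap clp]] : (set_val @ F) A.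
  by apply: (@filterS _ F _ setT) => [x _|]; [exact: set_valP|exact: filterT].
exists (SigSub (mem_set Ap)); split=> // B C FB [_ /= [[W oW <-] /= Wp WC]].
have [_ [[x Bx <-] Wx]] : (set_val @` B) `&` W !=set0.
  apply: clp; last by apply: open_nbhs_nbhs.
  by apply: (@filterS _ F _ B) => [x Bx|//]; exists x.
by exists x; split=> //; apply: WC.
Qed.

Lemma set_typeT_homeomorphic T : homeomorphic T (set_type [set: T]).
Proof.
exists (fun x => SigSub (mem_set (I : [set: T] x))), set_val; split=> //.
- by apply: continuous_comp_initial => x; exact: cvg_id.
- exact: initial_continuous.
- by move=> x; apply: val_inj.
Qed.

End Homeomorphic.

(** * The conditions at all scales give a Cantor set *)

Section CantorLike.
Context {R : realType} {X : metricType R}.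

Lemma cantor_at_scale_cantor_like (A : set X) : compact A ->
  (forall n, cantor_at_scale n.+1%:R^-1 A) -> cantor_like (set_type A).
Proof.
move=> cA sA.
have small (e : R) : 0 < e -> exists n, n.+1%:R^-1 < e.
  move=> e0; have [n _ /(_ n (leqnn n))] := near_infty_natSinv_lt (PosNum e0).
  by exists n.
have ballA (x : set_type A) e y : ball x e y = (mdist (val x) (val y) < e).
  by rewrite -[LHS]/(ball (val x) e (val y)) ballEmdist.
split.
(* A singleton open in [A] would contain a ball, hence the close neighbour of its point. *)
- apply/perfectTP => x ox; have := open_nbhs_nbhs (conj ox (erefl x)).
  rewrite -nbhs_ballE => -[e /= e0 xe]; have [n ne] := small e e0.
  have [[y [Ay yx xy]] _] := sA n (val x) (set_valP x).
  have /xe/= : ball x e (SigSub (mem_set Ay)) by rewrite ballA/= (lt_trans xy).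
  by move/(congr1 val)/eqP; rewrite /= (negbTE yx).
- exact: compact_set_type.
- apply: (injective_continuous_hausdorff (f := set_val)).
  + exact: val_inj.
  + exact: initial_continuous.
  + exact: metric_hausdorff.
- move=> x y xy; have := xy; rewrite -(inj_eq val_inj) -mdist_gt0.
  move=> /small[n nxy].
  have [_ [e /andP[e0 en] eA]] := sA n (val x) (set_valP x).
  (* As [e] is below the distance from [x] to [y], this ball separates them. It is clopen: a point
     outside it is at distance strictly above [e]. *)
  exists [set z | mdist (val x) (val z) < e]; split=> /=.
  + split; [rewrite openE => z /= xz|rewrite -openC openE => z /= /negP].
      rewrite /interior -nbhs_ballE.
      exists (e - mdist (val x) (val z)); first by rewrite /= subr_gt0.
      move=> w; rewrite ballA /= => zw.
      by have := metric_triangle (val x) (val z) (val w); lra.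
    rewrite -leNgt le_eqVlt eq_sym (negbTE (eA _ (set_valP z)))/= => xz.
    rewrite /interior -nbhs_ballE.
    exists (mdist (val x) (val z) - e); first by rewrite /= subr_gt0.
    move=> w; rewrite ballA /= => zw; apply/negP; rewrite -leNgt.
    have := metric_triangle (val x) (val w) (val z).
    by rewrite (metric_sym (val w)); lra.
  + by rewrite mdistxx.
  + by apply/negP; rewrite -leNgt ltW// (lt_trans en).
Qed.

End CantorLike.

(* The unused parameter [R] lets the metric instance depend on the field of
   distances. *)
Definition cantor_seq (R : realType) : Type := nat -> bool.

(** * The metric Cantor space as an attractor *)

Section CantorSeq.
Context {R : realType}.
Local Notation T := (cantor_seq R).
Implicit Types (x y z : T) (n : nat) (e : R).

Definition cantor_gap x y n : R := (x n != y n)%:R * 2^-1 ^+ n.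

(** For [x != y] the supremum is attained at the first index where they differ. In this form the
    metric axioms reduce to single coordinates. *)
Definition cantor_dist x y : R := sup (range (cantor_gap x y)).

Lemma cantor_gap_le1 x y n : cantor_gap x y n <= 1.
Proof.
rewrite /cantor_gap; case: (_ != _); rewrite ?mul0r// mul1r.
by rewrite exprn_ile1// ?invr_ge0// invf_le1// ler1n.
Qed.

Lemma cantor_distP x y e :
  cantor_dist x y <= e <-> forall n, cantor_gap x y n <= e.
Proof.
split=> [xye n|xye]; last first.
  by apply: ge_sup => [|_ [n _ <-]//]; exists (cantor_gap x y 0); exists 0.
apply: le_trans xye; apply: ub_le_sup; last by exists n.
by exists 1 => _ [m _ <-]; exact: cantor_gap_le1.
Qed.

Lemma cantor_gap_le_dist x y n : cantor_gap x y n <= cantor_dist x y.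
Proof. by move: n; apply/cantor_distP. Qed.

Lemma cantor_gap_ge0 x y n : 0 <= cantor_gap x y n.
Proof. by rewrite mulr_ge0// exprn_ge0// invr_ge0. Qed.

Lemma cantor_dist_ge0 x y : 0 <= cantor_dist x y.
Proof. exact: le_trans (cantor_gap_ge0 x y 0) (cantor_gap_le_dist _ _ _). Qed.

Lemma cantor_distxx x : cantor_dist x x = 0.
Proof.
apply/le_anti; rewrite cantor_dist_ge0 andbT; apply/cantor_distP => n.
by rewrite /cantor_gap eqxx mul0r.
Qed.

Lemma cantor_dist_positivity x y : cantor_dist x y = 0 -> x = y.
Proof.
move=> xy0; apply: functional_extensionality_dep => n.
have [//|xyn] := eqVneq (x n) (y n).
have := cantor_gap_le_dist x y n.
by rewrite xy0 /cantor_gap xyn mul1r leNgt exprn_gt0// invr_gt0.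
Qed.

Lemma cantor_dist_sym x y : cantor_dist x y = cantor_dist y x.
Proof.
rewrite /cantor_dist; congr (sup _); apply: eq_imagel => n _.
by rewrite /cantor_gap eq_sym.
Qed.

Lemma cantor_dist_triangle y x z :
  cantor_dist x z <= cantor_dist x y + cantor_dist y z.
Proof.
apply/cantor_distP => n.
apply: le_trans (lerD (cantor_gap_le_dist x y n) (cantor_gap_le_dist y z n)).
rewrite /cantor_gap -mulrDl ler_wpM2r ?exprn_ge0 ?invr_ge0// -natrD ler_nat.
by case: (x n) (y n) (z n) => [] [] [].
Qed.

HB.instance Definition _ := gen_eqMixin T.
HB.instance Definition _ := gen_choiceMixin T.
HB.instance Definition _ := isPointed.Build T (fun=> false).
HB.instance Definition _ := @isMetric.Build R T cantor_dist cantor_distxx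
  cantor_dist_positivity cantor_dist_sym cantor_dist_triangle.

Lemma cantor_dist_prefix x y n : (forall i, (i < n)%N -> x i = y i) ->
  mdist x y <= 2^-1 ^+ n :> R.
Proof.
move=> xy; apply/cantor_distP => m; rewrite /cantor_gap.
have [/xy ->|nm] := ltnP m n.
  by rewrite eqxx mul0r exprn_ge0// invr_ge0.
apply: (@le_trans _ _ (2^-1 ^+ m)); last first.
  by rewrite ler_wiXn2l// ?invr_ge0// invf_le1// ler1n.
by rewrite ler_piMl ?exprn_ge0 ?invr_ge0// lern1 leq_b1.
Qed.

Lemma half_exp_lt e : 0 < e -> exists n, 2^-1 ^+ n < e.
Proof.
move=> e0.
have : (2^-1 : R) ^+ n @[n --> \oo] --> (0 : R).
  by apply: cvg_expr; rewrite ger0_norm ?invr_ge0//; lra.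
move=> /cvgrPdist_lt/(_ e e0)[n _ /(_ n (leqnn n))].
by rewrite /= sub0r normrN ger0_norm ?exprn_ge0 ?invr_ge0//; exists n.
Qed.

Lemma cantor_space_prefix (x : cantor_space) n :
  \forall y \near x, forall i, (i < n)%N -> x i = y i.
Proof.
elim: n => [|n IH]; first by apply: (@filterE _ (nbhs x)) => y i.
have xn : \forall y \near x, (y : cantor_space) n = x n.
  exact: (@proj_continuous _ (fun=> bool) n x _ (discrete_set1 _)).
apply: (@filterS2 _ (nbhs x) _ _ _ _ _ IH xn) => y xy yn i.
by rewrite ltnS leq_eqVlt => /predU1P[->|/xy].
Qed.

Lemma cantor_space_to_seq_continuous :
  continuous (fun x : cantor_space => (x : nat -> bool) : T).
Proof.
move=> x; apply/metricType_numDomainType.cvgrPdist_lt => e /half_exp_lt[n ne].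
have := cantor_space_prefix x n; apply: filterS => y xy.
by apply: le_lt_trans ne; exact: cantor_dist_prefix.
Qed.

(** The identity from the product topology to the metric one is a continuous bijection from a
    compact space to a Hausdorff one. *)
Lemma cantor_space_homeomorphic_seq : homeomorphic cantor_space T.
Proof.
apply: compact_hausdorff_homeomorphic cantor_space_to_seq_continuous _.
- exact: cantor_space_compact.
- exact: metric_hausdorff.
- by exists (fun x => x).
Qed.

Lemma cantor_seq_compact : compact [set: T].
Proof.
have -> : [set: T] = (fun x : cantor_space => (x : nat -> bool) : T) @` setT.
  by apply/seteqP; split=> // x _; exists x.
apply: continuous_compact; last exact: cantor_space_compact.
exact/continuous_subspaceT/cantor_space_to_seq_continuous.
Qed.

Lemma cantor_seq_complete : complete_space T.
Proof.
move=> F PF cF; exists (lim F).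
exact: compact_cauchy_cvg cF filterT cantor_seq_compact.
Qed.

Definition cantor_cons (b : bool) x : T :=
  fun n => if n is m.+1 then x m else b.

Lemma cantor_cons_contraction b : metric_contraction (cantor_cons b).
Proof.
exists 2^-1; first by rewrite invr_ge0// invf_lt1// ltr1n ler0n.
(* Index 0 carries the common bit [b]; at [n.+1] the gap is half the old gap at [n]. *)
move=> x y; apply/cantor_distP => -[|n]; rewrite /cantor_gap/=.
  by rewrite eqxx mul0r mulr_ge0 ?invr_ge0// mdist_ge0.
by rewrite exprS mulrCA ler_wpM2l ?invr_ge0//; exact: cantor_gap_le_dist.
Qed.

(** The size argument 1 means two maps: index 0 prepends [false], index 1 prepends [true]. *)
Definition cantor_ifs : banach_ifs T :=
  @BanachIFS R T 1 (fun i => cantor_cons (i != ord0))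
    (fun i => cantor_cons_contraction _).

Definition cantor_full : hyperspace T :=
  Hyperspace cantor_seq_compact (ex_intro _ point I).

Lemma cantor_consE x : cantor_cons (x 0%N) (fun n => x n.+1) = x.
Proof. by apply/funext => -[]. Qed.

Lemma hutchinson_cons (K : hyperspace T) b x :
  hset K x -> hset (hutchinson cantor_ifs K) (cantor_cons b x).
Proof.
move=> Kx; exists (if b then ord_max else ord0) => //=.
by exists x => //; case: b.
Qed.

(** Each iteration prepends one arbitrary bit, so after [k] of them every word of length [k] occurs
    as a prefix, whatever [K] is. *)
Lemma iter_hutchinson_prefix (K : hyperspace T) k x :
  exists2 y, hset (iter k (hutchinson cantor_ifs) K) y &
    forall i, (i < k)%N -> x i = y i.
Proof.
elim: k x => [|k IH] x; first by have [y Ky] := hset_nonempty K; exists y.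
have [y Ky xy] := IH (fun n => x n.+1).
exists (cantor_cons (x 0%N) y); first exact: hutchinson_cons.
by move=> [|i]//; exact: xy.
Qed.

Lemma cantor_full_attractor : is_attractor cantor_ifs cantor_full.
Proof.
split=> [|K].
  apply: hyperspace_eq; apply/seteqP; split=> // x _.
  by rewrite -[x]cantor_consE; exact: hutchinson_cons.
apply/metricType_numDomainType.cvgrPdist_lt => e /half_exp_lt[n ne].
(* Agreement on [k >= n] bits puts each sequence within [2^-n] of the iterate; conversely the
   iterate lies in the full space. *)
exists n => // k /= nk; apply: le_lt_trans ne; apply: hdist_le => [x _|x _].
  have [y Ky xy] := iter_hutchinson_prefix K k x; exists y => //.
  by apply: cantor_dist_prefix => i /leq_trans/(_ nk); exact: xy.
by exists x => //; rewrite mdistxx exprn_ge0// invr_ge0.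
Qed.

End CantorSeq.

(** * Brouwer's characterization and the conclusion *)

Lemma cantor_like_homeomorphic (R : realType) (T : pseudoMetricType R) (t : T) :
  cantor_like T -> homeomorphic cantor_space T.
Proof.
move=> cT.
(* The characterization is applied to a pointed space, with [t] as the point. *)
pose PT : pseudoPMetricType R :=
  HB.pack (PseudoMetric.sort T) (isPointed.Build T t).
have [f [cf _]] := @homeomorphism_cantor_like R PT cT.
have [_ _ hT _] := cT.
exact: (@compact_hausdorff_homeomorphic cantor_space T f
  cantor_space_compact hT cf bijTT).
Qed.

Theorem theorem4p5 (R : realType) (X : metricType R)
    (completeX : complete_space X)
    (no_isolated : isolated [set: X] = set0) :
  residual [set K : hyperspace X |
    exists Y : metricType R, complete_space Y /\
      exists (F : banach_ifs Y) (A : hyperspace Y),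
        is_attractor F A /\ homeomorphic (set_type K) (set_type A)].
Proof.
apply: residualS (cantor_at_scale_residual no_isolated) => K /= sK.
exists (cantor_seq R); split; first exact: cantor_seq_complete.
exists cantor_ifs, cantor_full; split; first exact: cantor_full_attractor.
have [x Kx] := hset_nonempty K.
have cK := cantor_at_scale_cantor_like (hset_compact (h := K)) sK.
(* The chain runs from [K] through [cantor_space] and [cantor_seq R] to the full subset of the
   latter. *)
apply: (homeomorphic_trans (T := cantor_space)).
  apply: homeomorphic_sym.
  exact: (@cantor_like_homeomorphic R (set_type K) (SigSub (mem_set Kx)) cK).
apply: homeomorphic_trans cantor_space_homeomorphic_seq _.
exact: set_typeT_homeomorphic.
Qed.
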